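(* Let $\sigma\in\mathcal{P}$ be a fixed permutation, and let $\mathbb{P}_n^\sigma(\mu(\sigma,\tau)=0)$ denote the probability that $\mu(\sigma,\tau)=0$ when $\tau$ is chosen uniformly at random among the permutations in $\mathcal{S}_n$ that contain $\sigma$. Then, for every $\sigma$, $$\lim_{n\to\infty}\mathbb{P}_n^\sigma(\mu(\sigma,\tau)=0)=1.$$
   Context: $\mathcal{S}_n$ is the set of permutations of $\{1,\dots,n\}$ in one-line notation $\tau=\tau_1\tau_2\dots\tau_n$, with $|\tau|=n$. The reduction of a sequence of $k$ distinct positive integers is the permutation in $\mathcal{S}_k$ obtained by replacing the smallest entry by $1$, the second smallest by $2$, and so on. For $1\le i\le j\le n$, $\tau_{[i,j]}\in\mathcal{S}_{j-i+1}$ is the reduction of $\tau_i\dots\tau_j$. The consecutive pattern poset $\mathcal{P}$ is the set $\bigcup_{n\ge1}\mathcal{S}_n$ with $\sigma\le\tau$ iff $\sigma=\tau_{[i,j]}$ for some $i\le j$; in this case $\tau$ is said to contain $\sigma$. $\mu$ denotes the Möbius function of the poset $\mathcal{P}$: $\mu(\sigma,\sigma)=1$ and $\mu(\sigma,\tau)=-\sum_{\sigma\le\pi<\tau}\mu(\sigma,\pi)$ for $\sigma<\tau$. *)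

(* Defs.v *)
From HB Require Import structures.
From mathcomp Require Import all_boot all_order all_algebra all_fingroup.
From mathcomp Require Import zify.
From mathcomp Require Import all_classical all_reals all_analysis.

Set Implicit Arguments.
Unset Strict Implicit.
Unset Printing Implicit Defensive.

Import Order.TTheory GRing.Theory Num.Theory.
Import numFieldNormedType.Exports.

(* The library permutes {0, ..., n-1}; the shift makes the letters 1, ..., n. *)
Definition oneline (n : nat) (tau : 'S_n) : seq nat :=
  [seq (tau i : nat).+1 | i <- enum 'I_n].

(* The r-th smallest entry of a sequence of distinct numbers has exactly
   r - 1 entries below it. *)
Definition reduction (s : seq nat) : seq nat :=
  [seq (count (fun y => y < x) s).+1 | x <- s].

(* The factor s_i ... s_j, with positions counted from 0. *)
Definition factor (s : seq nat) (i j : nat) : seq nat :=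
  take (j - i).+1 (drop i s).

(* Permutations of length at least 1: the tag is the length minus one. *)
Definition cpp := {n : nat & 'S_n.+1}.
HB.instance Definition _ := Choice.on cpp.

Definition cpp_of (n : nat) (tau : 'S_n.+1) : cpp :=
  existT (fun n => 'S_n.+1) n tau.

Definition cpp_size (tau : cpp) : nat := (tag tau).+1.

Definition cpp_word (tau : cpp) : seq nat := oneline (tagged tau).

Definition cpp_le (sigma tau : cpp) : bool :=
  [exists i : 'I_(cpp_size tau), exists j : 'I_(cpp_size tau),
     (i <= j) && (cpp_word sigma == reduction (factor (cpp_word tau) i j))].

Lemma size_cpp_word tau : size (cpp_word tau) = cpp_size tau.
Proof. by rewrite /cpp_word /oneline size_map size_enum_ord. Qed.

Lemma cpp_word_inj : injective cpp_word.
Proof.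
move=> [m s] [n t] eq_st.
have eq_mn : m = n.
  by have := congr1 size eq_st; rewrite !size_cpp_word => -[].
subst n; congr existT; apply/permP => i; apply/val_inj.
move: eq_st; rewrite /cpp_word /oneline /= => /eq_in_map/(_ i).
by rewrite mem_enum => /(_ isT) [].
Qed.

Lemma reduction_map (f : nat -> nat) (s : seq nat) :
  {in s &, forall x y, (f x < f y) = (x < y)} ->
  reduction (map f s) = reduction s.
Proof.
move=> f_mono; rewrite /reduction -map_comp; apply/eq_in_map => x xs /=.
congr _.+1; rewrite count_map; apply/eq_in_count => y ys /=.
exact: f_mono.
Qed.

Lemma reduction_oneline n (tau : 'S_n) : reduction (oneline tau) = oneline tau.
Proof.
rewrite /reduction -map_comp; apply: eq_map => i /=.
congr _.+1; rewrite count_map.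
have -> : count (preim (fun k : 'I_n => (tau k : nat).+1)
                       (fun y => y < (tau i : nat).+1)) (enum 'I_n)
        = #|[set k : 'I_n | (tau k < tau i)]|.
  rewrite -sum1_count big_enum_cond -sum1_card; apply: eq_bigl => k.
  by rewrite inE /= ltnS.
rewrite -(card_imset _ (@perm_inj _ tau)).
have -> : tau @: [set k | tau k < tau i] = [set k : 'I_n | k < tau i].
  apply/setP => k; rewrite inE; apply/imsetP/idP => [[l + ->]|lt_k].
    by rewrite inE.
  by exists ((tau^-1)%g k); rewrite ?inE permKV.
rewrite -sum1dep_card (big_ord_narrow (ltnW (ltn_ord (tau i)))).
by rewrite sum_nat_const card_ord muln1.
Qed.

Lemma reduction_factor (s : seq nat) (i j : nat) :
  reduction (factor (reduction s) i j) = reduction (factor s i j).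
Proof.
rewrite /factor {2}/reduction -map_drop -map_take; apply: reduction_map.
have count_le x y : x <= y ->
    count (fun z => z < x) s <= count (fun z => z < y) s.
  by move=> xy; apply: sub_count => z /= zx; apply: leq_trans xy.
have count_lt x y : x \in s -> x < y ->
    count (fun z => z < x) s < count (fun z => z < y) s.
  move=> xs xy; have [s1 [s2 ->]] : exists s1 s2, s = s1 ++ x :: s2.
    by case/splitPr: xs => s1 s2; exists s1, s2.
  rewrite !count_cat /= ltnn xy add0n add1n addnS ltnS.
  by apply: leq_add; apply: sub_count => z /= zx; apply: ltn_trans xy.
move=> x y /mem_take/mem_drop xs /mem_take/mem_drop ys; rewrite ltnS.
have [xy|yx] := ltnP x y; first exact: count_lt.
by apply/negbTE; rewrite -leqNgt; apply: count_le.
Qed.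

Lemma factor_factor (s : seq nat) (i j k l : nat) :
  i <= j -> k + j <= l -> factor (factor s k l) i j = factor s (k + i) (k + j).
Proof.
move=> ij kjl; rewrite /factor.
have ilk : i <= (l - k).+1 by lia.
rewrite -(subnK ilk) -take_drop drop_drop addnC take_takel; last by lia.
by rewrite subnDl addnC.
Qed.

Lemma cpp_leP (sigma tau : cpp) :
  reflect (exists i j, [/\ i <= j, j < cpp_size tau
             & cpp_word sigma = reduction (factor (cpp_word tau) i j)])
          (cpp_le sigma tau).
Proof.
apply: (iffP existsP) => [[i /existsP[j /andP[ij /eqP e]]]|[i [j [ij jt e]]]].
  by exists i, j; split.
exists (Ordinal (leq_ltn_trans ij jt)); apply/existsP; exists (Ordinal jt).
by rewrite /= ij e eqxx.
Qed.

Lemma size_factor (s : seq nat) (i j : nat) :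
  i <= j -> j < size s -> size (factor s i j) = (j - i).+1.
Proof.
move=> ij js; rewrite /factor size_takel // size_drop.
by rewrite -subSn // leq_sub2r.
Qed.

Lemma cpp_le_size (sigma tau : cpp) :
  cpp_le sigma tau -> cpp_size sigma <= cpp_size tau.
Proof.
case/cpp_leP => i [j [ij jt e]].
rewrite -size_cpp_word e size_map size_factor ?size_cpp_word //.
by rewrite (leq_trans _ jt) // ltnS leq_subr.
Qed.

Fact cpp_le_refl : reflexive cpp_le.
Proof.
move=> tau; apply/cpp_leP; exists 0, (cpp_size tau).-1; split=> //.
rewrite /factor drop0 subn0 prednK // -size_cpp_word take_size.
by rewrite reduction_oneline.
Qed.

Lemma cpp_le_eq (sigma tau : cpp) :
  cpp_le sigma tau -> cpp_size sigma = cpp_size tau -> sigma = tau.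
Proof.
case/cpp_leP => i [j [ij jt e]] st; apply: cpp_word_inj.
have := size_cpp_word sigma.
rewrite e size_map size_factor ?size_cpp_word // st => eji.
have [i0 jE] : i = 0 /\ (j - i).+1 = cpp_size tau by split; lia.
by rewrite /factor i0 -i0 jE i0 drop0 -size_cpp_word take_size reduction_oneline.
Qed.

Fact cpp_le_anti : antisymmetric cpp_le.
Proof.
move=> sigma tau /andP[st ts]; apply: cpp_le_eq => //.
by apply/eqP; rewrite eqn_leq !cpp_le_size.
Qed.

Fact cpp_le_trans : transitive cpp_le.
Proof.
move=> pi sigma tau /cpp_leP[i [j [ij jp es]]] /cpp_leP[k [l [kl lt ep]]].
have pE : cpp_size pi = (l - k).+1.
  by rewrite -size_cpp_word ep size_map size_factor ?size_cpp_word.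
have kjl : k + j <= l by lia.
apply/cpp_leP; exists (k + i), (k + j); split; try lia.
by rewrite es ep reduction_factor factor_factor.
Qed.

Fact cpp_display : Order.disp_t. Proof. exact: Order.Disp tt tt. Qed.

HB.instance Definition _ :=
  Order.Le_isPOrder.Build cpp_display cpp cpp_le_refl cpp_le_anti cpp_le_trans.

Lemma cpp_lt_size (sigma tau : cpp) :
  (sigma < tau)%O -> cpp_size sigma < cpp_size tau.
Proof.
rewrite lt_neqAle => /andP[neq_st le_st].
rewrite ltn_neqAle cpp_le_size // andbT; apply: contraNneq neq_st => eq_st.
by apply/eqP; apply: cpp_le_eq.
Qed.

(* m bounds the depth of the recursion, and any m >= |tau| gives the same value.
   If sigma is not below tau, the sum is empty and the value is 0. *)
Fixpoint mobius_rec (m : nat) (sigma tau : cpp) : int :=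
  if sigma == tau then 1%R else
  if m is m'.+1 then
    (- \sum_(k < cpp_size tau)
         \sum_(pi : 'S_k.+1 | (sigma <= cpp_of pi)%O && (cpp_of pi < tau)%O)
            mobius_rec m' sigma (cpp_of pi))%R
  else 0%R.

Definition mobius (sigma tau : cpp) : int :=
  mobius_rec (cpp_size tau) sigma tau.

Lemma mobius_rec_stable (m n : nat) (sigma tau : cpp) :
  cpp_size tau <= m -> cpp_size tau <= n ->
  mobius_rec m sigma tau = mobius_rec n sigma tau.
Proof.
elim: m n tau => [|m IHm] [|n] tau //= tm tn; case: ifP => // _.
congr (- _)%R; apply: eq_bigr => k _; apply: eq_bigr => pi /andP[_ lt_pi].
have := cpp_lt_size lt_pi => lt_size.
by apply: IHm; rewrite -ltnS (leq_trans lt_size).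
Qed.

Lemma mobius_refl (sigma : cpp) : mobius sigma sigma = 1%R.
Proof. by rewrite /mobius /= eqxx. Qed.

(* Every pi < tau is shorter than tau, so the sum ranges over all of
   [sigma, tau[. *)
Lemma mobius_lt (sigma tau : cpp) : (sigma < tau)%O ->
  mobius sigma tau =
  (- \sum_(k < cpp_size tau)
       \sum_(pi : 'S_k.+1 | (sigma <= cpp_of pi)%O && (cpp_of pi < tau)%O)
          mobius sigma (cpp_of pi))%R.
Proof.
move=> st; rewrite {1}/mobius [LHS]/= (lt_eqF st).
congr (- _)%R; apply: eq_bigr => k _; apply: eq_bigr => pi /andP[_ lt_pi].
by apply: mobius_rec_stable => //; rewrite -ltnS (cpp_lt_size lt_pi).
Qed.

Definition containing (n : nat) (sigma : cpp) : {set 'S_n.+1} :=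
  [set tau | (sigma <= cpp_of tau)%O].

(* The probability for S_n; it is 0 when n < |sigma|, where no permutation
   contains sigma. *)
Definition prob_mobius0 (R : realType) (sigma : cpp) (n : nat) : R :=
  if n is n'.+1 then
    (#|[set tau in containing n' sigma | mobius sigma (cpp_of tau) == 0%R]|%:R
     / #|containing n' sigma|%:R)%R
  else 0%R.

(* Main.v *)
Require Import Defs.
From mathcomp Require Import all_boot all_order all_algebra all_fingroup.
From mathcomp Require Import zify lra.
From mathcomp Require Import all_classical all_reals all_analysis.

Set Implicit Arguments.
Unset Strict Implicit.
Unset Printing Implicit Defensive.

Import Order.TTheory GRing.Theory Num.Theory.
Import numFieldNormedType.Exports.
Import Defs.

(** Let p and q be the patterns obtained from tau by deleting its last and its
    first letter, and i the one obtained by deleting both.  Everything strictly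
    below tau is below p or below q.  If everything below both p and q is
    already below i, inclusion-exclusion writes the sum of mu(sigma, rho) over
    sigma <= rho < tau as S(p) + S(q) - S(i), where S(x) is the sum over the
    interval [sigma, x].  The three sums vanish as soon as sigma differs from
    p, q and i, which holds when |tau| - |sigma| > 2; hence mu(sigma, tau) = 0
    ([mobius_eq0]).

    A pattern below both p and q but not below i occurs in tau only as a
    proper prefix and as a proper suffix: it is a border of tau.  It remains to
    see that few permutations of size N have a border that is not below i.  Fix
    a large K ([meet_coatoms_interior]).
    - A border of length at most K is harmless when the pattern of the first K
      letters occurs again in the interior of tau.
    - A border of length N - D with D < K forces tau to be order-periodic with
      period D, hence also with every multiple of D; so, once N >= 3 K, there is
      another border with shift in [K, N - K].  Only borders whose shift D lies
      in [K, N - K] have to be counted.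

    All the counting comes from one independence principle ([card_pat]): the
    pattern of a window is uniformly distributed on any set of permutations
    that is stable under rearranging that window.  It gives
    - probability at most 1 / min(D, N - D)! for a border with shift D, and the
      sum over K <= D <= N - K is at most 4 / K! ([sum_borders]);
    - probability (1 - 1/K!)^m that the first of m + 1 disjoint blocks of
      length K has a pattern different from all the others ([card_norecur]),
      which for K fixed is small once m is large;
    - in the same way, probability at least 1/2, for N large, that tau contains
      sigma ([containing_frequent]).
    So the permutations with mu(sigma, tau) <> 0 form a vanishing proportion of
    those that contain sigma. *)

(** * Patterns of windows *)

Lemma std_exists k (f : 'I_k -> nat) : injective f ->
  exists s : 'S_k, forall i l, (s i < s l) = (f i < f l).
Proof.
move=> f_inj; pose A i := [set l | f l < f i].
have A_lt i l : f i < f l -> #|A i| < #|A l|.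
  move=> lt_il; apply/proper_card/properP; split.
    by apply/fintype.subsetP=> x; rewrite !inE => /ltn_trans; apply.
  by exists i; rewrite !inE ?ltnn.
have A_small i : #|A i| < k.
  rewrite -[X in _ < X]card_ord -cardsT; apply/proper_card/properP.
  by split; [exact: finset.subsetT | exists i; rewrite !inE ?ltnn].
have rank_inj : injective (fun i => Ordinal (A_small i)).
  move=> i l [eq_il]; apply: f_inj; apply/eqP; case: ltngtP => // /A_lt;
  by rewrite eq_il ltnn.
exists (perm rank_inj) => i l; rewrite !permE /=.
have [/A_lt //|/leq_trans le_li] := ltnP (f i) (f l).
apply/negbTE; rewrite -leqNgt subset_leq_card //.
by apply/fintype.subsetP=> x; rewrite !inE => lt_xl; apply: leq_trans lt_xl (le_li _ _).
Qed.

(** The standardization of an injective word; on other words the value is a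
    dummy, which keeps the function free of proof arguments. *)
Definition std k (f : 'I_k -> nat) : 'S_k :=
  odflt 1%g [pick s : 'S_k | [forall i, forall l, (s i < s l) == (f i < f l)]].

Lemma stdP k (f : 'I_k -> nat) : injective f ->
  forall i l, (std f i < std f l) = (f i < f l).
Proof.
move=> /std_exists [s sf] i l; rewrite /std; case: pickP => [t|/(_ s)/negP[]].
  by move/forallP/(_ i)/forallP/(_ l)/eqP.
by apply/forallP=> x; apply/forallP=> y; rewrite sf.
Qed.

(** A permutation cannot rearrange the letters of W nontrivially and keep their
    relative order: x and g x would be preceded by equally many letters of W,
    so they carry the same value. *)
Lemma perm_on_rigid (T : finType) (f : T -> nat) (W : {set T}) (g : {perm T}) :
  perm_on W g -> {in W &, injective f} ->
  {in W &, forall x y, (f (g x) < f (g y)) = (f x < f y)} -> g = 1%g.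
Proof.
move=> gW f_inj fg; apply/permP => x; rewrite perm1.
have [xW|xW] := boolP (x \in W); last exact: out_perm gW xW.
pose A u := [set y in W | f y < f u].
have gxW : g x \in W by rewrite (perm_closed _ gW).
have A_lt u v : u \in W -> v \in W -> f u < f v -> #|A u| < #|A v|.
  move=> uW vW lt_uv; apply/proper_card/properP; split.
    apply/fintype.subsetP=> z; rewrite !inE => /andP[-> /ltn_trans].
    by apply.
  by exists u; rewrite !inE ?uW ?ltnn.
have eqA : #|A x| = #|A (g x)|.
  rewrite -(card_imset _ (@perm_inj _ g)); apply: eq_card => y.
  apply/imsetP/idP => [[z]|].
    rewrite !inE => /andP[zW lt_zx] ->.
    by rewrite (perm_closed _ gW) zW fg.
  rewrite inE => /andP[yW lt_y].
  have zW : (g^-1)%g y \in W by rewrite -(perm_closed _ gW) permKV.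
  by exists ((g^-1)%g y); rewrite ?permKV // inE zW -fg ?permKV.
apply: f_inj => //; apply/eqP; case: ltngtP => // /A_lt;
  by rewrite eqA ltnn => ->.
Qed.

Lemma std_eqP k (f g : 'I_k -> nat) : injective f -> injective g ->
  (std f = std g) <-> (forall i l, (f i < f l) = (g i < g l)).
Proof.
move=> f_inj g_inj; split=> [eq_fg i l | eq_fg].
  by rewrite -(stdP f_inj) -(stdP g_inj) eq_fg.
suff: (std f * (std g)^-1 = 1)%g by move/eqP; rewrite -eq_mulgV1 => /eqP.
apply: (@perm_on_rigid _ (fun i => std g i : nat) [set: 'I_k]).
- by apply/fintype.subsetP=> x; rewrite inE.
- by move=> x y _ _ /val_inj/perm_inj.
by move=> x y _ _; rewrite !permM !permKV !stdP.
Qed.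

(** The pattern of tau on the positions a, ..., a + k - 1, meaningful when
    a + k <= n.+1. *)
Definition pat k n (a : nat) (tau : 'S_n.+1) : 'S_k :=
  std (fun i : 'I_k => tau (inord (a + i)) : nat).

Lemma win_inj k n a : a + k <= n.+1 ->
  injective (fun i : 'I_k => inord (a + i) : 'I_n.+1).
Proof.
move=> akn i l /(congr1 (@nat_of_ord _)); have := ltn_ord i; have := ltn_ord l.
by move=> ? ?; rewrite !inordK; [move=> /addnI/val_inj | lia | lia].
Qed.

Lemma tau_win_inj k n a (tau : 'S_n.+1) : a + k <= n.+1 ->
  injective (fun i : 'I_k => tau (inord (a + i)) : nat).
Proof. by move=> akn i l /val_inj/perm_inj/win_inj; apply. Qed.

Lemma patP k n a (tau : 'S_n.+1) : a + k <= n.+1 -> forall i l : 'I_k,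
  (pat k a tau i < pat k a tau l)
    = (tau (inord (a + i)) < tau (inord (a + l))).
Proof. by move=> akn i l; rewrite stdP //; apply: tau_win_inj. Qed.

Lemma pat_eqP k n m a b (tau : 'S_n.+1) (pi : 'S_m.+1) :
    a + k <= n.+1 -> b + k <= m.+1 ->
  pat k a tau = pat k b pi <-> (forall i l, i < k -> l < k ->
    (tau (inord (a + i)) < tau (inord (a + l)))
      = (pi (inord (b + i)) < pi (inord (b + l)))).
Proof.
move=> akn bkn; rewrite std_eqP; try exact: tau_win_inj.
split=> [eq_ab i l ik lk | eq_ab i l]; last exact: eq_ab.
exact: (eq_ab (Ordinal ik) (Ordinal lk)).
Qed.

Lemma pat_sub k n a b c j (tau : 'S_n.+1) :
    a + k <= n.+1 -> b + k <= n.+1 -> c + j <= k ->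
  pat k a tau = pat k b tau -> pat j (a + c) tau = pat j (b + c) tau.
Proof.
move=> akn bkn cjk /pat_eqP eq_ab; apply/pat_eqP; try lia.
by move=> i l ij lj; rewrite -!addnA; apply: eq_ab; lia.
Qed.

Lemma reduction_order k (f g : 'I_k -> nat) :
  (forall i l, (f i < f l) = (g i < g l)) ->
  reduction [seq f i | i <- enum 'I_k] = reduction [seq g i | i <- enum 'I_k].
Proof.
move=> eq_fg; rewrite /reduction -!map_comp; apply: eq_map => i /=.
by congr _.+1; rewrite !count_map; apply: eq_count => l /=.
Qed.

Lemma size_oneline n (tau : 'S_n) : size (oneline tau) = n.
Proof. by rewrite size_map size_enum_ord. Qed.

Lemma oneline_pat k n a (tau : 'S_n.+1) : a + k <= n ->
  oneline (pat k.+1 a tau) = reduction (factor (oneline tau) a (a + k)).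
Proof.
move=> akn; rewrite -[LHS]reduction_oneline.
have -> : factor (oneline tau) a (a + k)
    = [seq (tau (inord (a + i)) : nat).+1 | i : 'I_k.+1 <- enum 'I_k.+1].
  have szn : size (oneline tau) = n.+1 by rewrite size_map size_enum_ord.
  apply: (@eq_from_nth _ 0) => [|i].
    by rewrite size_factor ?szn ?leq_addr // size_map size_enum_ord addKn.
  rewrite size_factor ?szn ?leq_addr //.
  rewrite addKn => ik; rewrite nth_take; last by lia.
  rewrite nth_drop (nth_map ord0) ?size_enum_ord; last by lia.
  rewrite (nth_map ord0) ?size_enum_ord //; last by lia.
  congr (nat_of_ord (tau _)).+1.
  by apply: val_inj; rewrite /= !nth_enum_ord ?inordK; lia.
by apply: (reduction_order (f := fun i => (pat k.+1 a tau i : nat).+1)) => i l;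
  rewrite !ltnS patP //; lia.
Qed.

(** Comparison with a factor of tau is read directly in the word of tau, so that
    p, q, i and tau can all be compared inside the same word. *)
Lemma le_patP k n a (tau : 'S_n.+1) (rho : cpp) : a + k <= n ->
  reflect (exists c d, [/\ a <= c, c <= d, d <= a + k
             & cpp_word rho = reduction (factor (oneline tau) c d)])
          (rho <= cpp_of (pat k.+1 a tau))%O.
Proof.
move=> akn; apply: (iffP (cpp_leP _ _)) => [[i [j]]|[c [d]]].
  rewrite {2}/cpp_word /cpp_size /= => -[ij jk ->].
  exists (a + i), (a + j); split; try lia.
  by rewrite oneline_pat // reduction_factor factor_factor //; lia.
move=> [ac cd dak ->]; exists (c - a), (d - a); rewrite /cpp_size /=; split; try lia.
rewrite /cpp_word /= oneline_pat // reduction_factor factor_factor; try lia.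
by congr (reduction (factor _ _ _)); lia.
Qed.

Lemma cpp_le_permP n (tau : 'S_n.+1) (rho : cpp) :
  reflect (exists c d, [/\ c <= d, d <= n
             & cpp_word rho = reduction (factor (oneline tau) c d)])
          (rho <= cpp_of tau)%O.
Proof.
by apply: (iffP (cpp_leP _ _)) => -[i [j [ij jn e]]]; exists i, j.
Qed.

(** * Vanishing of the Moebius function *)

Definition sum_over (M : nat) (F : cpp -> int) (P : pred cpp) : int :=
  (\sum_(k < M) \sum_(rho : 'S_k.+1 | P (cpp_of rho)) F (cpp_of rho))%R.

Lemma eq_sum_over M F P Q : P =1 Q -> sum_over M F P = sum_over M F Q.
Proof. by move=> PQ; apply: eq_bigr => k _; apply: eq_bigl => rho. Qed.

Lemma sum_overID M F Q P :
  sum_over M F P = (sum_over M F [pred rho | P rho && Q rho]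
             + sum_over M F [pred rho | P rho && ~~ Q rho])%R.
Proof.
rewrite /sum_over -big_split; apply: eq_bigr => k _ /=.
by rewrite (bigID (fun rho => Q (cpp_of rho))).
Qed.

Lemma sum_over1 M F rho : cpp_size rho <= M -> sum_over M F (pred1 rho) = F rho.
Proof.
case: rho => r rho rM; rewrite /sum_over (bigD1 (Ordinal rM)) //=.
rewrite [X in (_ + X)%R]big1 ?addr0 => [|k kr].
  by rewrite (big_pred1 rho) // => pi /=; rewrite -tag_eqE /tag_eq /= eqxx tagged_asE.
apply: big_pred0 => pi /=; apply/negbTE; apply: contraNneq kr => e.
by apply/eqP/val_inj; rewrite /=; have := congr1 tag e.
Qed.

(** The cutoff M only has to exceed the sizes involved, so sums over intervals
    with different tops can be compared at a common M. *)
Lemma sum_over_trunc m M F (P : pred cpp) : m <= M ->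
  (forall rho, P rho -> cpp_size rho <= m) -> sum_over M F P = sum_over m F P.
Proof.
move=> mM Pm; rewrite /sum_over.
rewrite [RHS](big_ord_widen M
  (fun k => \sum_(rho : 'S_k.+1 | P (cpp_of rho)) F (cpp_of rho))%R) //.
rewrite [LHS](bigID (fun k : 'I_M => k < m)) /= [X in (_ + X)%R]big1 ?addr0 //.
move=> k km; apply: big_pred0 => rho; apply/negbTE; apply: contraNN km => /Pm.
by [].
Qed.

Lemma mobius_interval_sum M (sigma tau : cpp) : cpp_size tau <= M -> sigma != tau ->
  sum_over M (mobius sigma) [pred rho | (sigma <= rho <= tau)%O] = 0%R.
Proof.
move=> tauM st; have [le_st|nle_st] := boolP (sigma <= tau)%O; last first.
  rewrite /sum_over big1 // => k _; apply: big_pred0 => rho /=; apply/negbTE.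
  by apply: contraNN nle_st => /andP[]; apply: le_trans.
have lt_st : (sigma < tau)%O by rewrite lt_neqAle st.
rewrite (sum_overID _ _ (pred1 tau)).
rewrite (@eq_sum_over _ _ _ (pred1 tau)) ?sum_over1 //; last first.
  move=> rho /=; rewrite andbC; case: eqP => //= ->.
  by rewrite le_st lexx.
rewrite [X in (_ + X)%R](@eq_sum_over _ _ _
           ( [pred rho | (sigma <= rho)%O && (rho < tau)%O])); last first.
  by move=> rho /=; rewrite lt_neqAle andbA [RHS]andbAC.
rewrite (sum_over_trunc _ tauM).
  by rewrite (mobius_lt lt_st) addNr.
by move=> rho /andP[_ /cpp_lt_size/ltnW].
Qed.

(** A shorter factor misses the first or the last letter of tau. *)
Lemma lt_cpp_coatoms n (tau : 'S_n.+2) (rho : cpp) :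
  (rho < cpp_of tau)%O
    = (rho <= cpp_of (pat n.+1 0 tau))%O || (rho <= cpp_of (pat n.+1 1 tau))%O.
Proof.
have coatom a : a <= 1 -> (cpp_of (pat n.+1 a tau) < cpp_of tau)%O.
  move=> a1; rewrite lt_neqAle; apply/andP; split.
    by apply/eqP=> /(congr1 cpp_size) /eqP; rewrite /cpp_size /= -[X in _ == X]addn1; lia.
  have : (cpp_of (pat n.+1 a tau) <= cpp_of (pat n.+1 a tau))%O by exact: lexx.
  case/le_patP; first by lia.
  move=> c [d [ac cd da e]]; apply/cpp_le_permP; exists c, d; split=> //; lia.
apply/idP/orP => [lt_rt|[]]; last first.
- by move=> /le_lt_trans; apply; apply: coatom.
- by move=> /le_lt_trans; apply; apply: coatom.
have := cpp_lt_size lt_rt; rewrite {2}/cpp_size /= => szr.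
have /cpp_le_permP [c [d [cd dn e]]] := ltW lt_rt.
have := size_cpp_word rho.
rewrite e size_map size_factor ?size_oneline //.
move=> dc; have [c0|c0] := posnP c; [left|right]; apply/le_patP; try lia.
  by exists c, d; split=> //; lia.
by exists c, d; split=> //; lia.
Qed.

(** Inclusion-exclusion over the two coatoms: the hypothesis makes the meet of
    the two principal ideals principal, with top i, and the sum of mu over a
    nontrivial interval is 0. *)
Lemma mobius_eq0 n (sigma : cpp) (tau : 'S_n.+3) :
    cpp_size sigma <= n -> (sigma <= cpp_of tau)%O ->
    (forall rho, (rho <= cpp_of (pat n.+2 0 tau))%O ->
                 (rho <= cpp_of (pat n.+2 1 tau))%O ->
                 (rho <= cpp_of (pat n.+1 1 tau))%O) ->
  mobius sigma (cpp_of tau) = 0%R.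
Proof.
move=> szs le_st meet_pq.
set p := cpp_of (pat n.+2 0 tau) in meet_pq.
set q := cpp_of (pat n.+2 1 tau) in meet_pq.
set i := cpp_of (pat n.+1 1 tau) in meet_pq.
have neq_s (x : cpp) : n < cpp_size x -> sigma != x.
  by move=> nx; apply/eqP=> e; move: nx; rewrite -e ltnNge szs.
have lt_st : (sigma < cpp_of tau)%O.
  by rewrite lt_neqAle le_st andbT neq_s // /cpp_size /=; lia.
have /le_patP le_i : (i <= i)%O by exact: lexx.
have [|c [d [c1 cd dn ei]]] := le_i _; first by lia.
have ip : (i <= p)%O by apply/le_patP; [lia | exists c, d; split=> //; lia].
have iq : (i <= q)%O by apply/le_patP; [lia | exists c, d; split=> //; lia].
have meet_pqE rho : ((rho <= p) && (rho <= q) = (rho <= i))%O.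
  apply/andP/idP => [[]|ri]; first exact: meet_pq.
  by split; apply: le_trans ri _.
rewrite (mobius_lt lt_st)
  -/(sum_over _ _ (fun pi => (sigma <= pi)%O && (pi < cpp_of tau)%O)).
set F := mobius sigma; set M := cpp_size _.
apply/eqP; rewrite oppr_eq0; apply/eqP.
have sum0 x : n < cpp_size x <= M ->
    sum_over M F [pred rho | (sigma <= rho <= x)%O] = 0%R.
  by move=> /andP[nx xM]; rewrite mobius_interval_sum // neq_s.
have {}sum0 : [/\ sum_over M F [pred rho | (sigma <= rho <= p)%O] = 0%R,
    sum_over M F [pred rho | (sigma <= rho <= q)%O] = 0%R &
    sum_over M F [pred rho | (sigma <= rho <= i)%O] = 0%R].
  by split; apply: sum0; rewrite /M /cpp_size /=; lia.
have ltE rho := lt_cpp_coatoms tau rho.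
rewrite -/p -/q in ltE; case: sum0 => sum_p sum_q sum_i.
clearbody F M p q i.
rewrite (sum_overID _ _ [pred rho | (rho <= p)%O]).
rewrite [X in (X + _)%R](@eq_sum_over _ _ _
  [pred rho | (sigma <= rho <= p)%O]); last first.
  by move=> rho /=; rewrite ltE; case: (rho <= p)%O; rewrite ?andbF ?andbT.
rewrite sum_p add0r -[RHS]sum_q [RHS](sum_overID _ _ [pred rho | (rho <= p)%O]).
rewrite [X in _ = (X + _)%R](@eq_sum_over _ _ _
  [pred rho | (sigma <= rho <= i)%O]); last first.
  by move=> rho /=; rewrite -meet_pqE [RHS]andbA [RHS]andbAC.
rewrite sum_i add0r; apply: eq_sum_over => rho /=.
by rewrite ltE; case: (rho <= p)%O; rewrite ?andbF.
Qed.

(** * Borders *)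

Lemma oneline_inj n : injective (@oneline n).
Proof.
move=> s t /eq_in_map eq_st; apply/permP => i; apply: val_inj.
by have [] := eq_st i (mem_enum _ _).
Qed.

(** A border with shift e is an order-period e, and periods are closed under
    multiples: slide along windows at distance e. *)
Lemma bifix_mul n e m (tau : 'S_n.+1) : m * e <= n.+1 ->
  pat (n.+1 - e) 0 tau = pat (n.+1 - e) e tau ->
  pat (n.+1 - m * e) 0 tau = pat (n.+1 - m * e) (m * e) tau.
Proof.
move=> men per; elim: m men => [|m IHm] men; first by rewrite !mul0n.
have e0 : e <= n.+1 by lia.
transitivity (pat (n.+1 - m.+1 * e) (m * e) tau).
  have := @pat_sub (n.+1 - m * e) n 0 (m * e) 0 (n.+1 - m.+1 * e) tau.
  by rewrite !add0n !addn0; apply; [lia | lia | lia | apply: IHm; lia].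
have := @pat_sub (n.+1 - e) n 0 e (m * e) (n.+1 - m.+1 * e) tau.
by rewrite -mulSn add0n; apply=> //; lia.
Qed.

(** A pattern rho below both p and q that is not below i is a border of tau.
    If |rho| <= K, then rho sits at the start of the prefix of length K, which
    occurs again strictly inside tau.  Otherwise the shift c' of the border is
    at most n.+3 - K; either c' >= K, or some multiple of c' lies in ]K, 2K],
    and both cases contradict the absence of borders with shift in
    [K, n.+3 - K]. *)
Lemma meet_coatoms_interior n K (tau : 'S_n.+3) : 0 < K -> 3 * K <= n.+3 ->
    (forall D, K <= D <= n.+3 - K ->
       pat (n.+3 - D) 0 tau <> pat (n.+3 - D) D tau) ->
    (exists a, [/\ 0 < a, a + K <= n.+2 & pat K a tau = pat K 0 tau]) ->
  forall rho, (rho <= cpp_of (pat n.+2 0 tau))%O ->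
    (rho <= cpp_of (pat n.+2 1 tau))%O -> (rho <= cpp_of (pat n.+1 1 tau))%O.
Proof.
move=> K0 K3 nobifix [a [a0 aK patK]] rho rho_p rho_q.
have /le_patP [//|c [d [_ cd dn e]]] := rho_p.
have /le_patP [|c' [d' [c1' cd' dn' e']]] := rho_q; first by lia.
apply/le_patP; first by lia.
case: (posnP c) => [c0|c0]; last by exists c, d; split=> //; lia.
have [d'n|d'n] := leqP d' n.+1; first by exists c', d'; split=> //; lia.
have {d'n} d'E : d' = n.+2 by lia.
move: cd dn e; rewrite c0 => _ dn e.
have c'E : c' = n.+2 - d.
  have := congr1 size e; rewrite e' !size_map !size_factor ?size_oneline //; lia.
have border : pat d.+1 0 tau = pat d.+1 c' tau.
  apply: oneline_inj; rewrite !oneline_pat ?add0n; try lia.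
  by rewrite -e e' c'E d'E subnK //; lia.
have [dK|Kd] := ltnP d K.
  exists a, (a + d); split; try lia.
  rewrite e -oneline_pat; last by lia.
  have <- : pat d.+1 0 tau = pat d.+1 a tau.
    have := @pat_sub K _ 0 a 0 d.+1 tau.
    by rewrite !addn0; apply; try lia; rewrite patK.
  by rewrite oneline_pat //; lia.
have per : pat (n.+3 - c') 0 tau = pat (n.+3 - c') c' tau.
  by have -> : n.+3 - c' = d.+1 by lia.
have [Kc|cK] := leqP K c'; first by case: (nobifix c'); [lia|].
have := leq_trunc_div K c'; have := ltn_ceil K c1' => lt_K le_K.
by case: (nobifix ((K %/ c').+1 * c')); [lia | apply: bifix_mul => //; lia].
Qed.

(** * Independence and uniformity of window patterns *)

Definition window n (a k : nat) : {set 'I_n.+1} := [set x : 'I_n.+1 | a <= x < a + k].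

Lemma windowP n a k (x : 'I_n.+1) : x \in window n a k ->
  exists i : 'I_k, x = inord (a + i).
Proof.
rewrite inE => /andP[ax xak]; have xk : x - a < k by lia.
by exists (Ordinal xk); apply: val_inj; rewrite /= inordK; have := ltn_ord x; lia.
Qed.

Lemma mem_window n a k (i : nat) : a + k <= n.+1 -> i < k ->
  inord (a + i) \in window n a k.
Proof. by move=> akn ik; rewrite inE inordK; lia. Qed.

Lemma card_window n a k : a + k <= n.+1 -> #|window n a k| = k.
Proof.
move=> akn; rewrite -[RHS]card_ord -cardsT -(card_imset _ (win_inj akn)).
apply: eq_card => x; apply/idP/imsetP => [/windowP [i ->]|[i _ ->]].
  by exists i.
by apply: mem_window.
Qed.

Lemma pat_outside n a k b j (g tau : 'S_n.+1) :
    perm_on (window n a k) g -> (b + j <= a) || (a + k <= b) ->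
    b + j <= n.+1 -> pat j b (g * tau)%g = pat j b tau.
Proof.
move=> gW ba bj; apply/pat_eqP=> // i l ij lj.
have out x : x < j -> g (inord (b + x)) = inord (b + x).
  by move=> xj; apply: (out_perm gW); rewrite inE inordK; lia.
by rewrite !permM !out.
Qed.

(** Rigidity makes the map from rearrangements of the window to patterns
    injective, and both sides have k! elements. *)
Lemma pat_rearrange n a k (tau : 'S_n.+1) (pi : 'S_k) : a + k <= n.+1 ->
  #|[set g | perm_on (window n a k) g & pat k a (g * tau)%g == pi]| = 1.
Proof.
move=> akn; set W := window n a k; pose H := [set g | perm_on W g].
pose phi (g : 'S_n.+1) := pat k a (g * tau)%g.
have phi_inj : {in H &, injective phi}.
  move=> g h; rewrite !inE => gW hW /pat_eqP eq_gh.
  suff: (g * h^-1 = 1)%g by move/eqP; rewrite -eq_mulgV1 => /eqP.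
  apply: (@perm_on_rigid _ (fun x => (h * tau)%g x : nat) W).
  - by rewrite perm_onM // perm_onV.
  - by move=> x y _ _ /val_inj/perm_inj.
  move=> x y /windowP [i ->] /windowP [l ->].
  by rewrite !permM !permKV -!permM eq_gh.
have /setP/(_ pi) : phi @: H = [set: 'S_k].
  apply/eqP; rewrite eqEcard finset.subsetT card_in_imset // cardsT card_Sn.
  by rewrite cardsE card_perm card_window ?leqnn.
rewrite inE => /imsetP [g gH ->].
rewrite -(cards1 g); apply: eq_card => h; rewrite !inE.
apply/andP/eqP => [[hW /eqP]|->]; last by rewrite inE in gH.
by apply: phi_inj => //; rewrite inE.
Qed.

(** Double counting of the pairs (g, tau), with g a rearrangement of the window,
    tau in N, and pi the pattern of g tau: each tau has one g, while each g gives
    as many tau as there are permutations in N with pattern pi. *)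
Lemma card_pat n a k (N : {set 'S_n.+1}) (pi : 'S_k) : a + k <= n.+1 ->
    (forall g tau, perm_on (window n a k) g -> tau \in N -> (g * tau)%g \in N) ->
  #|[set tau in N | pat k a tau == pi]| * k`! = #|N|.
Proof.
move=> akn invN; set W := window n a k.
have invNE g tau : perm_on W g -> ((g * tau)%g \in N) = (tau \in N).
  move=> gW; apply/idP/idP; last exact: invN.
  by move=> /(invN g^-1%g _ (perm_onV gW)); rewrite mulKg.
have <- : #|[set g | perm_on W g]| = k`! by rewrite cardsE card_perm card_window.
rewrite mulnC -sum_nat_const -[RHS]sum1_card.
transitivity (\sum_(g in [set g | perm_on W g])
                 \sum_(tau in N | pat k a (g * tau)%g == pi) 1).
  apply: eq_bigr => g; rewrite inE => gW.
  rewrite -sum1_card (reindex_inj (mulgI g)); apply: eq_bigl => tau.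
  by rewrite inE invNE.
rewrite (exchange_big_dep (mem N)) /=; last by move=> ? ? _ /andP[].
apply: eq_bigr => tau tauN; rewrite sum1dep_card -[RHS](pat_rearrange tau pi akn).
by apply: eq_card => g; rewrite !inE tauN.
Qed.

Lemma card_fibers (T S : finType) (A : {set T}) (f : T -> S) :
  \sum_(y : S) #|[set x in A | f x == y]| = #|A|.
Proof.
rewrite -[RHS]sum1_card (partition_big f xpredT) //=; apply: eq_bigr => y _.
by rewrite -sum1_card; apply: eq_bigl => x; rewrite inE.
Qed.

(** When the pattern of the first window is fixed, the disjoint second window
    has this pattern with probability 1 / j!. *)
Lemma card_border n D j : j <= D -> D + j <= n.+1 ->
  #|[set tau : 'S_n.+1 | pat j 0 tau == pat j D tau]| * j`! = n.+1`!.
Proof.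
move=> jD Djn; rewrite -(card_fibers _ (pat j 0)) big_distrl /=.
rewrite -(card_Sn n.+1) -cardsT -(card_fibers _ (pat j 0)); apply: eq_bigr => pi _.
rewrite -(@card_pat n D j [set tau in [set: 'S_n.+1] | pat j 0 tau == pi] pi) //.
  congr (_ * _); apply: eq_card => tau; rewrite !inE /= andbC.
  by case: eqP => // ->; rewrite eq_sym.
by move=> g tau gW; rewrite !inE /= (pat_outside _ gW) //; lia.
Qed.

(** The blocks are numbered from 1: block 0 is left free, so that N may
    prescribe the pattern of the prefix. *)
Definition avoid n K (N : {set 'S_n.+1}) (pi : 'S_K) m :=
  [set tau in N | all (fun t => pat K (t * K) tau != pi) (iota 1 m)].

(** The blocks are disjoint, so each of them multiplies the count by
    (K! - 1) / K!. *)
Lemma card_avoid n K (N : {set 'S_n.+1}) (pi : 'S_K) m : m.+1 * K <= n.+1 ->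
    (forall g tau : 'S_n.+1, (forall x : 'I_n.+1, x < K -> g x = x) -> tau \in N ->
       (g * tau)%g \in N) ->
  #|avoid N pi m| * K`! ^ m = #|N| * K`!.-1 ^ m.
Proof.
move=> mKn invN; elim: m mKn => [|m IHm] mKn.
  by rewrite !expn0 !muln1; apply: eq_card => tau; rewrite inE andbT.
have {}IHm := IHm ltac:(lia).
have invAv g tau : perm_on (window n (m.+1 * K) K) g -> tau \in avoid N pi m ->
    (g * tau)%g \in avoid N pi m.
  move=> gW; rewrite !inE => /andP[tauN /allP av]; apply/andP; split.
    by apply: invN => // x xK; apply: (out_perm gW); rewrite inE; lia.
  apply/allP=> t tm; rewrite (pat_outside _ gW) ?av //.
    by rewrite mem_iota in tm; apply/orP; left; rewrite addnC -mulSn leq_mul2r; lia.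
  rewrite mem_iota in tm; rewrite addnC -mulSn.
  by apply: leq_trans mKn; rewrite leq_mul2r; lia.
have := @card_pat _ _ _ (avoid N pi m) pi _ invAv; rewrite addnC -mulSn => /(_ mKn).
set C := [set _ in _ | _] => cardC.
have -> : avoid N pi m.+1 = avoid N pi m :\: C.
  apply/setP=> tau; rewrite !inE -[X in iota 1 X]addn1 iotaD all_cat /= andbT add1n.
  by case: (tau \in N) => //=; case: (all _ _); rewrite ?andbF ?andbT.
have CA : C \subset avoid N pi m by apply/fintype.subsetP=> tau; rewrite inE => /andP[].
rewrite cardsD (finset.setIidPr CA) expnS mulnA mulnBl cardC.
by rewrite -{2}[#|avoid N pi m|]muln1 -mulnBr subn1 mulnAC IHm -mulnA -expnSr.
Qed.

Definition norecur n K m : {set 'S_n.+1} :=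
  [set tau | all (fun t => pat K (t * K) tau != pat K 0 tau) (iota 1 m)].

Lemma card_norecur n K m : m.+1 * K <= n.+1 ->
  #|norecur n K m| * K`! ^ m = n.+1`! * K`!.-1 ^ m.
Proof.
move=> mKn; rewrite -(card_fibers _ (pat K 0)) big_distrl /=.
rewrite -(card_Sn n.+1) -cardsT -(card_fibers _ (pat K 0)) big_distrl /=.
apply: eq_bigr => pi _; rewrite -(card_avoid pi mKn).
  congr (_ * _); apply: eq_card => tau; rewrite !inE /= andbC.
  by case: eqP => // ->.
move=> g tau gK; rewrite !inE /= => /eqP <-; apply/eqP; apply/pat_eqP; try lia.
by move=> i l iK lK; rewrite !permM !gK //; rewrite inordK; lia.
Qed.

Lemma card_noncontaining n K m (pi : 'S_K.+1) : m.+1 * K.+1 <= n.+1 ->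
  #|~: containing n (cpp_of pi)| * K.+1`! ^ m <= n.+1`! * K.+1`!.-1 ^ m.
Proof.
move=> mKn; rewrite -(card_Sn n.+1) -cardsT -(card_avoid pi mKn);
  last by move=> *; rewrite inE.
rewrite leq_mul2r; apply/orP; right; apply/subset_leq_card/fintype.subsetP=> tau.
rewrite !inE /=; apply: contraNT => /allPn [t].
rewrite mem_iota negbK => /andP[t0 tm] /eqP e.
have tK : t * K.+1 + K <= n.
  have : t.+1 * K.+1 <= m.+1 * K.+1 by rewrite leq_mul2r; lia.
  by rewrite mulSn; lia.
apply/cpp_le_permP; exists (t * K.+1), (t * K.+1 + K); split=> //; first by lia.
by rewrite -oneline_pat // e.
Qed.

(** * Permutations with a nonzero Moebius value *)

Definition borders n D : {set 'S_n.+1} :=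
  [set tau | pat (n.+1 - D) 0 tau == pat (n.+1 - D) D tau].

(** The windows of a border of length n.+1 - D overlap when D is small; the
    shorter windows of length min(D, n.+1 - D) at the same places do not. *)
Lemma card_borders n D : D <= n.+1 ->
  #|borders n D| * (minn D (n.+1 - D))`! <= n.+1`!.
Proof.
move=> Dn; rewrite -(@card_border n D (minn D (n.+1 - D))); [|lia|lia].
rewrite leq_mul2r; apply/orP; right; apply/subset_leq_card/fintype.subsetP=> tau.
rewrite !inE => /eqP eqD; apply/eqP.
have := @pat_sub (n.+1 - D) n 0 D 0 (minn D (n.+1 - D)) tau.
by rewrite !addn0; apply=> //; lia.
Qed.

Lemma mobius_neq0_sub n K m sigma : 0 < K -> 3 * K <= n.+3 ->
    m.+1 * K <= n.+2 -> cpp_size sigma <= n ->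
  [set tau in containing n.+2 sigma | mobius sigma (cpp_of tau) != 0%R]
    \subset norecur n.+2 K m
            :|: \bigcup_(D < n.+4 - K | K <= D) borders n.+2 D.
Proof.
move=> K0 K3 mKn szs; apply/fintype.subsetP=> tau; rewrite !inE => /andP[le_st].
apply: contraNT; rewrite negb_or => /andP[/allPn[t]].
rewrite mem_iota negbK => /andP[t0 tm] /eqP recur /finset.bigcupP nobifix.
apply/eqP; apply: mobius_eq0 => //; apply: (@meet_coatoms_interior _ K) => //.
  move=> D KD eqD; apply: nobifix.
  have Dlt : D < n.+4 - K by lia.
  by exists (Ordinal Dlt); rewrite /= ?inE ?eqD //; case/andP: KD.
have tmK : t.+1 * K <= m.+1 * K by rewrite leq_mul2r; lia.
exists (t * K); split=> //; first by rewrite muln_gt0 t0.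
by move: tmK; rewrite mulSn; lia.
Qed.

Lemma card_mobius_neq0 n K m sigma : 0 < K -> 3 * K <= n.+3 ->
    m.+1 * K <= n.+2 -> cpp_size sigma <= n ->
  #|[set tau in containing n.+2 sigma | mobius sigma (cpp_of tau) != 0%R]|
    <= #|norecur n.+2 K m| + \sum_(K <= D < n.+4 - K) #|borders n.+2 D|.
Proof.
move=> K0 K3 mKn szs.
apply: leq_trans (subset_leq_card (mobius_neq0_sub K0 K3 mKn szs)) _.
apply: leq_trans (leq_card_setU _ _) _; rewrite leq_add2l big_geq_mkord.
exact: unstable.card_big_setU.
Qed.

Local Open Scope classical_set_scope.
Local Open Scope ring_scope.

(** * Limits *)

Lemma invfact_tail (R : realType) K L : (0 < K)%N ->
  \sum_(K <= D < L) (D`!%:R^-1 : R) <= 2 / K`!%:R.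
Proof.
move=> K0; have fact_pos D : 0 < (D`!%:R : R) by rewrite ltr0n fact_gt0.
have [KL|LK] := leqP K L; last first.
  by rewrite big_geq ?divr_ge0 ?ltW // ltnW.
(* The bound telescopes because 1 / L! <= 2 / L! - 2 / (L + 1)! for L >= 1. *)
suff: \sum_(K <= D < L) (D`!%:R^-1 : R) <= 2 / K`!%:R - 2 / L`!%:R.
  by move=> /le_trans; apply; rewrite gerBl divr_ge0 // ltW.
elim: L KL => [|L IHL]; first by rewrite leqn0 (gtn_eqF K0).
rewrite leq_eqVlt => /predU1P[<-|]; first by rewrite big_geq // subrr.
rewrite ltnS => KL; rewrite big_nat_recr //=.
apply: le_trans (lerD (IHL KL) (lexx _)) _.
have : 2 / (L.+1)`!%:R <= L`!%:R^-1 :> R.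
  rewrite factS natrM invfM mulrA ler_piMl ?invr_ge0 ?(ltW (fact_pos _)) //.
  by rewrite ler_pdivrMr ?ltr0n // mul1r ler_nat; lia.
lra.
Qed.

(** Since 1 / min(D, N - D)! <= 1 / D! + 1 / (N - D)!, the sum over shifts is at
    most twice the tail of the series of 1 / D!, whatever the size N. *)
Lemma sum_borders (R : realType) n K : (0 < K)%N ->
  (\sum_(K <= D < n.+2 - K) #|borders n D|)%:R <= 4 / K`!%:R * n.+1`!%:R :> R.
Proof.
move=> K0; have fact_pos D : 0 < (D`!%:R : R) by rewrite ltr0n fact_gt0.
rewrite -ler_pdivrMr // natr_sum mulr_suml.
apply: (@le_trans _ _ (\sum_(K <= D < n.+2 - K)
                         ((D`!%:R^-1 : R) + (n.+1 - D)`!%:R^-1))).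
  rewrite big_nat_cond [leRHS]big_nat_cond; apply: ler_sum => D /andP[/andP[KD Dn] _].
  apply: (@le_trans _ _ ((minn D (n.+1 - D))`!%:R^-1)).
    rewrite ler_pdivrMr // ler_pdivlMl // -natrM ler_nat mulnC.
    by apply: card_borders; lia.
  by case: leqP => _; rewrite ?lerDl ?lerDr invr_ge0 ltW.
rewrite big_split /= [X in _ + X]big_nat_rev /=.
rewrite [X in _ + X](@eq_big_nat _ _ _ _ _ _ (fun D => D`!%:R^-1)); last first.
  by move=> D KD; congr (_`!%:R^-1); lia.
have := invfact_tail R (n.+2 - K) K0; lra.
Qed.

Lemma pow_fact_small (R : realType) K (e : R) : 0 < e ->
  exists m, (K`!.-1)%:R ^+ m <= e * K`!%:R ^+ m.
Proof.
move=> e0; have fact_pos D : 0 < (D`!%:R : R) by rewrite ltr0n fact_gt0.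
have q1 : `|(K`!.-1)%:R / K`!%:R : R| < 1.
  rewrite ger0_norm ?divr_ge0 // ltr_pdivrMr // mul1r ltr_nat.
  by rewrite prednK ?fact_gt0.
have /cvgrPdist_le /(_ e e0) [m _ small] := cvg_expr q1; exists m.
have := small m (leqnn m); rewrite sub0r normrN ger0_norm.
  by rewrite expr_div_n ler_pdivrMr // exprn_gt0.
by rewrite exprn_ge0 // divr_ge0.
Qed.

Lemma mobius_neq0_rare (R : realType) (sigma : cpp) (e : R) : 0 < e ->
  exists n0, forall n, (n0 <= n)%N ->
    #|[set tau in containing n.+2 sigma | mobius sigma (cpp_of tau) != 0]|%:R
      <= e * n.+3`!%:R.
Proof.
move=> e0; have fact_pos D : 0 < (D`!%:R : R) by rewrite ltr0n fact_gt0.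
have e2 : 0 < e / 2 by lra.
(* K is chosen first, for the borders, and only then m, for the recurrence of
   the prefix of length K. *)
have [K [K0 Ke]] : exists K, (0 < K)%N /\ 4 / K`!%:R <= e / 2 :> R.
  have [K Ke] : exists K : nat, 8 / e < K%:R.
    by exists (Num.truncn (8 / e)).+1; rewrite truncnS_gt.
  have K0 : (0 < K)%N.
    by rewrite -(ltr0n R); apply: lt_trans Ke; rewrite divr_gt0.
  exists K; split=> //; rewrite ler_pdivrMr //.
  have : K%:R <= K`!%:R :> R by rewrite ler_nat fact_geq.
  move: Ke; rewrite ltr_pdivrMr // => Ke KK.
  have : K%:R * e <= K`!%:R * e by rewrite ler_pM2r.
  lra.
have [m mK] := pow_fact_small K e2.
exists (3 * K + m.+1 * K + cpp_size sigma)%N => n n0n.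
have bound := @card_mobius_neq0 n K m sigma K0 ltac:(lia) ltac:(lia) ltac:(lia).
apply: (@le_trans _ _ (#|norecur n.+2 K m|%:R
          + (\sum_(K <= D < n.+4 - K) #|borders n.+2 D|)%:R)).
  by rewrite -natrD ler_nat.
have rec : #|norecur n.+2 K m|%:R <= e / 2 * n.+3`!%:R :> R.
  have Km : 0 < (K`!%:R ^+ m : R) by rewrite exprn_gt0.
  rewrite -(ler_pM2r Km) -natrX -natrM (@card_norecur n.+2 K m); last by lia.
  by rewrite natrM !natrX mulrAC mulrC ler_wpM2r // ltW.
have := sum_borders R n.+2 K0.
have : 4 / K`!%:R * n.+3`!%:R <= e / 2 * n.+3`!%:R :> R by rewrite ler_wpM2r // ltW.
lra.
Qed.

Lemma containing_frequent (R : realType) (sigma : cpp) :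
  exists n0, forall n, (n0 <= n)%N ->
    n.+1`!%:R <= 2 * #|containing n sigma|%:R :> R.
Proof.
case: sigma => K pi; have e0 : 0 < (1 / 2 : R) by lra.
have [m mK] := pow_fact_small (R := R) K.+1 e0; exists (m.+1 * K.+1)%N => n n0n.
have Km : 0 < (K.+1`!%:R ^+ m : R) by rewrite exprn_gt0 // ltr0n fact_gt0.
have : #|~: containing n (cpp_of pi)|%:R <= 1 / 2 * n.+1`!%:R :> R.
  rewrite -(ler_pM2r Km) -natrX -natrM.
  apply: (@le_trans _ _ (n.+1`! * K.+1`!.-1 ^ m)%:R).
    by rewrite ler_nat; apply: card_noncontaining; lia.
  by rewrite natrM !natrX mulrAC mulrC ler_wpM2r.
have := cardsC (containing n (cpp_of pi)); rewrite card_Sn => <-.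
rewrite natrD -/(cpp_of pi); lra.
Qed.

Theorem corollary6p9 (R : realType) (sigma : cpp) :
  prob_mobius0 R sigma n @[n --> \oo] --> (1 : R).
Proof.
apply/cvgrPdist_le => e e0.
have e2 : 0 < e / 2 by lra.
have [n1 rare] := mobius_neq0_rare sigma e2.
have [n2 freq] := containing_frequent R sigma.
exists (n1 + n2).+3 => // n0 /= n0P.
have [n nE] : exists n, n0 = n.+3 by exists n0.-1.-1.-1; lia.
rewrite {n0}nE in n0P *; rewrite /prob_mobius0.
have {}rare := rare n ltac:(lia); have {}freq := freq n.+2 ltac:(lia).
set C := containing _ _ in rare freq *.
set B := [set _ in _ | _ != _] in rare; set G := [set _ in _ | _].
(* One minus the probability is |B| / |C|, with |B| <= (e / 2) N! and
   |C| >= N! / 2. *)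
have -> : #|G| = (#|C| - #|B|)%N.
  rewrite -(cardsID G C) (finset.setIidPr _); last first.
    by apply/fintype.subsetP=> tau; rewrite inE => /andP[].
  suff -> : C :\: G = B by rewrite addnK.
  by apply/setP=> tau; rewrite !inE; case: (_ <= _)%O; rewrite ?andbF ?andbT.
have BC : (#|B| <= #|C|)%N.
  by apply/subset_leq_card/fintype.subsetP=> tau; rewrite inE => /andP[].
have C0 : 0 < (#|C|%:R : R).
  have : 0 < (n.+3`!%:R : R) by rewrite ltr0n fact_gt0.
  lra.
rewrite natrB // mulrBl divff ?gt_eqF // subKr ger0_norm ?divr_ge0 //.
rewrite ler_pdivrMr //; apply: le_trans rare _.
have : e / 2 * n.+3`!%:R <= e / 2 * (2 * #|C|%:R) by rewrite ler_pM2l.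
lra.
Qed.
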